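(* For every integer $\ell \geq 2$, every graph $G$ with at least one vertex that is $\{P_5,K_{\ell,\ell}\}$-free has a vertex $v$ such that $\alpha(G[N[v]]) < 2\ell$.
   Context: Graphs are finite and simple. $P_5$ is the path on $5$ vertices, $K_{\ell,\ell}$ the complete bipartite graph with parts of size $\ell$. A graph is $\mathcal{F}$-free if it has no induced subgraph isomorphic to a member of $\mathcal{F}$. $N[v]$ is the closed neighborhood of $v$ (its neighbors together with $v$) and $\alpha$ denotes the independence number (maximum size of an independent set). *)

(* Defs.v *)
From mathcomp Require Import all_boot.

Set Implicit Arguments.
Unset Strict Implicit.
Unset Printing Implicit Defensive.

Record sgraph := SGraph {
  vertex :> finType;
  adj : rel vertex;
  adj_sym : symmetric adj;
  adj_irrefl : irreflexive adj
}.

Definition iso (G H : sgraph) : Prop :=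
  exists2 f : G -> H, bijective f & forall x y, adj (f x) (f y) = adj x y.

Section Induced.
Variables (G : sgraph) (S : {set G}).

Definition induced_adj : rel {x : G | x \in S} :=
  fun x y => adj (val x) (val y).

Lemma induced_adj_sym : symmetric induced_adj.
Proof. by move=> x y; apply: adj_sym. Qed.

Lemma induced_adj_irrefl : irreflexive induced_adj.
Proof. by move=> x; apply: adj_irrefl. Qed.

Definition induced : sgraph := SGraph induced_adj_sym induced_adj_irrefl.
End Induced.

Definition free (F : sgraph -> Prop) (G : sgraph) : Prop :=
  forall H : sgraph, F H -> ~ exists S : {set G}, iso (induced S) H.

(* The path on n vertices (so n - 1 edges). *)
Section Path.
Variable n : nat.

Definition path_adj : rel 'I_n :=
  fun i j => (i.+1 == j :> nat) || (j.+1 == i :> nat).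

Lemma path_adj_sym : symmetric path_adj.
Proof. by move=> i j; rewrite /path_adj orbC. Qed.

Lemma path_adj_irrefl : irreflexive path_adj.
Proof. by move=> i; rewrite /path_adj orbb eqn_leq ltnn. Qed.

Definition path_graph : sgraph := SGraph path_adj_sym path_adj_irrefl.
End Path.

Section CompleteBipartite.
Variables m n : nat.

Definition biclique_adj : rel ('I_m + 'I_n)%type :=
  fun x y => match x, y with
             | inl _, inr _ | inr _, inl _ => true
             | _, _ => false
             end.

Lemma biclique_adj_sym : symmetric biclique_adj.
Proof. by move=> [?|?] [?|?]. Qed.

Lemma biclique_adj_irrefl : irreflexive biclique_adj.
Proof. by move=> [?|?]. Qed.

Definition biclique : sgraph := SGraph biclique_adj_sym biclique_adj_irrefl.
End CompleteBipartite.

Definition closed_neigh (G : sgraph) (v : G) : {set G} :=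
  [set u | (u == v) || adj v u].

Definition independent (G : sgraph) (A : {set G}) : bool :=
  [forall x in A, forall y in A, ~~ adj x y].

Definition alpha (G : sgraph) : nat :=
  \max_(A : {set G} | independent A) #|A|.

(* Main.v *)
Require Import Defs.
From mathcomp Require Import all_boot.

Set Implicit Arguments.
Unset Strict Implicit.
Unset Printing Implicit Defensive.

(**
Suppose every neighbourhood N(v) contains an independent set X_v with at least
2l vertices. Fix a vertex w and a maximum independent set I of N(w). For i in
I, P5-freeness makes the sets N(j) ∩ X_i (j in I) a chain; write i -> j when
this set has at least l elements. As G has no K_{l,l}, every i has fewer than l
out-neighbours (i itself is one), and more than l vertices of X_i form a set
Z_i with no edge to the j in I such that i -/-> j. If i -/-> j and j -/-> i, then
Z_i and Z_j are anticomplete (an edge between them would force, by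
P5-freeness, a K_{l,l}), so w is complete to Z_i or to Z_j, since otherwise
z_i, i, w, j, z_j is an induced P5. Counting arcs, |I| >= 2l shows that w is
complete to some Z_i; trading the out-neighbours of i for Z_i in I yields a
larger independent subset of N(w).
*)

(** * Forbidden induced subgraphs as explicit vertex configurations *)

Lemma free_no_embedding (F : sgraph -> Prop) (G H : sgraph) (g : H -> G) :
  free F G -> F H -> injective g ->
  ~ (forall x y, adj (g x) (g y) = adj x y).
Proof.
move=> frG FH g_inj g_adj; apply: (frG H FH).
exists [set g x | x in H].
have im_g (u : {x | x \in [set g x | x in H]}) : exists x, g x == val u.
  by case: u => u /= /imsetP[x _ ->]; exists x.
(* [iso] asks for a map from the induced subgraph to [H], hence the inverse of [g] on its image,
   obtained by choosing preimages. *)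
exists (fun u => xchoose (im_g u)).
  exists (fun x => exist _ (g x) (imset_f g (isT : x \in H))) => [u | x].
    by apply: val_inj => /=; apply/eqP/(xchooseP (im_g u)).
  by apply: g_inj; apply/eqP/(xchooseP (im_g _)).
move=> u v; rewrite -g_adj.
by rewrite (eqP (xchooseP (im_g u))) (eqP (xchooseP (im_g v))).
Qed.

Lemma independentP (G : sgraph) (A : {set G}) :
  reflect {in A &, forall x y, ~~ adj x y} (independent A).
Proof.
apply: (iffP forall_inP) => [indA x y xA yA | indA x xA].
  exact: (forall_inP (indA x xA)).
by apply/forall_inP => y; apply: indA.
Qed.

Lemma free_no_P5 (F : sgraph -> Prop) (G : sgraph) (a b c d e : G) :
  free F G -> F (path_graph 5) ->
  adj a b -> adj b c -> adj c d -> adj d e ->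
  ~~ adj a c -> ~~ adj a d -> ~~ adj a e -> ~~ adj b d -> ~~ adj b e ->
  ~~ adj c e -> False.
Proof.
move=> frG FP ab bc cd de /negbTE ac /negbTE ad /negbTE ae /negbTE bd.
move=> /negbTE be /negbTE ce.
pose g (i : path_graph 5) := nth a [:: a; b; c; d; e] i.
have g_adj x y : adj (g x) (g y) = adj x y.
  case: x y => [[|[|[|[|[|//]]]]] ?] [[|[|[|[|[|//]]]]] ?];
  by rewrite /g /= ?adj_irrefl // 1?adj_sym // ?(ab, bc, cd, de) //
     ?(ac, ad, ae, bd, be, ce) // adj_sym ?(ab, bc, cd, de) //
     ?(ac, ad, ae, bd, be, ce).
apply: (free_no_embedding frG FP _ g_adj) => x y gxy.
(* No two vertices of P5 have the same neighbourhood. *)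
have twin z : adj x z = adj y z by rewrite -!g_adj gxy.
apply: val_inj; move: (twin ord0) (twin (inord 1)) (twin (inord 2)).
move: (twin (inord 3)) (twin (inord 4)).
rewrite /= /path_adj !inordK //; case: x y {gxy twin} => [x ltx] [y lty] /=.
by case: x y ltx lty => [|[|[|[|[|//]]]]] [|[|[|[|[|//]]]]].
Qed.

Lemma free_no_biclique (F : sgraph -> Prop) (G : sgraph) (l : nat)
    (A B : {set G}) :
  free F G -> F (biclique l l) -> independent A -> independent B ->
  {in A & B, forall a b, adj a b} -> l <= #|A| -> l <= #|B| -> False.
Proof.
move=> frG FK /independentP indA /independentP indB AB lA lB.
(* [A] and [B] may be larger than [l]: the first [l] elements of each are used. *)
pose g (x : biclique l l) : G := match x with
  | inl i => enum_val (widen_ord lA i)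
  | inr j => enum_val (widen_ord lB j)
  end.
have gA i : g (inl i) \in A by apply: enum_valP.
have gB i : g (inr i) \in B by apply: enum_valP.
have g_adj x y : adj (g x) (g y) = adj x y.
  case: x y => [i|i] [j|j]; rewrite [RHS]/=.
  - exact/negbTE/indA.
  - exact: AB.
  - by rewrite adj_sym AB.
  - exact/negbTE/indB.
apply: (free_no_embedding frG FK _ g_adj) => x y gxy.
have neq i j : g (inl i) <> g (inr j).
  by move=> gij; have:= AB _ _ (gA i) (gB j); rewrite gij adj_irrefl.
case: x y gxy => [i|i] [j|j] gij.
- by move: gij => /enum_val_inj/(congr1 val)/= /val_inj ->.
- by case: (neq _ _ gij).
- by case: (neq _ _ (esym gij)).
- by move: gij => /enum_val_inj/(congr1 val)/= /val_inj ->.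
Qed.

(** * Traces of neighbourhoods on an independent set *)

Section P5BicliqueFree.

Variables (G : sgraph) (l : nat).
Hypothesis l_gt0 : 0 < l.
Hypothesis G_free : free (fun H => H = path_graph 5 \/ H = biclique l l) G.

Let N (v : G) : {set G} := [set u | adj v u].

(** If [x] in [X] sees [j] but not [k], and [y] in [X] sees [k] but not [j], then [j, x, i, y, k] is
    an induced P5. So traces on [X] are nested, and their sizes decide the direction. *)
Lemma neigh_chain (I X : {set G}) (i : G) :
  independent I -> independent X -> i \in I -> X \subset N i ->
  {in I &, forall j k, #|N j :&: X| <= #|N k :&: X| ->
                       N j :&: X \subset N k}.
Proof.
move=> /independentP indI /independentP indX iI /subsetP Xi j k jI kI le_jk.
apply/subsetP => x /[!inE] /andP[jx xX]; apply/negPn/negP => kx.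
suff /(@proper_card G) : N k :&: X \proper N j :&: X by rewrite ltnNge le_jk.
rewrite properE; apply/andP; split; last first.
  by apply/subsetPn; exists x; rewrite !inE ?jx ?xX // (negbTE kx).
apply/subsetP => y /[!inE] /andP[ky yX]; rewrite yX andbT.
apply/negPn/negP => jy.
have:= Xi x xX; have:= Xi y yX; rewrite !inE => iy ix.
apply: (@free_no_P5 _ G j x i y k G_free (or_introl erefl));
  rewrite // 1?adj_sym //; try exact: indI; try exact: indX.
Qed.

(** By the chain property, the smallest trace of size at least [l] lies in all the other such
    traces; with [l] heavy vertices it would span a K_{l,l}. *)
Lemma few_heavy (I X : {set G}) (i : G) :
  independent I -> independent X -> i \in I -> X \subset N i ->
  #|[set j in I | l <= #|N j :&: X|]| < l.
Proof.
move=> indI indX iI Xi; rewrite ltnNge; apply/negP.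
set A := [set j in I | _] => lA.
have /card_gt0P[j0 j0A] : 0 < #|A| by apply: leq_trans lA.
case: (@arg_minnP _ j0 [in A] (fun j => #|N j :&: X|) j0A) => j jA j_min.
move: (jA); rewrite !inE => /andP[jI lj].
apply: (@free_no_biclique _ G l A (N j :&: X) G_free (or_intror erefl)) => //.
- apply/independentP => x y /[!inE] /andP[xI _] /andP[yI _].
  exact: (elimT (independentP _) indI).
- apply/independentP => x y /[!inE] /andP[_ xX] /andP[_ yX].
  exact: (elimT (independentP _) indX).
move=> k x kA xjX; have:= j_min k kA; move: kA; rewrite inE => /andP[kI _].
move=> /(neigh_chain indI indX iI Xi jI kI)/subsetP/(_ x xjX).
by rewrite inE.
Qed.

(** The largest trace of size below [l] contains all the light ones, so deleting it from [X]
    separates the rest from every light vertex at once. *)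
Lemma light_core (I X : {set G}) (i : G) :
  independent I -> independent X -> i \in I -> X \subset N i -> 2 * l <= #|X| ->
  exists Z : {set G}, [/\ Z \subset X, l < #|Z| &
    {in I & Z, forall j z, #|N j :&: X| < l -> ~~ adj j z}].
Proof.
move=> indI indX iI Xi lX.
case: (pickP [pred j in I | #|N j :&: X| < l]) => [j0 j0P | none].
  case: (arg_maxnP (fun j => #|N j :&: X|) j0P) => j /= /andP[jI jl] j_max.
  exists (X :\: N j); split; first exact: subsetDl.
    (* At most [l - 1] of at least [2 * l] vertices are deleted, so more than [l] remain. *)
    rewrite cardsD setIC ltn_subRL; apply: leq_trans lX.
    by rewrite mul2n -addnn ltn_add2r.
  move=> k z kI /[!inE] /andP[jz zX] kl; apply: contraNN jz => kz.
  have le_kj : #|N k :&: X| <= #|N j :&: X| by apply: j_max; rewrite /= kI.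
  have/subsetP/(_ z) := neigh_chain indI indX iI Xi kI jI le_kj.
  by rewrite !inE kz zX => ->.
exists X; split=> //.
  by apply: leq_trans lX; rewrite mul2n -addnn -[X in X < _]addn0 ltn_add2l.
by move=> j z jI _ jl; have:= none j; rewrite /= jI jl.
Qed.

(** A single edge [y z] spreads: a vertex [y'] of [Y] missing [z] gives the induced P5
    [y', i, y, z, j], and symmetrically in [Z]. Hence [Y] would be complete to [Z], a K_{l,l}. *)
Lemma private_anticomplete (i j : G) (Y Z : {set G}) :
  ~~ adj i j -> independent Y -> independent Z ->
  {in Y, forall y, adj i y && ~~ adj j y} ->
  {in Z, forall z, adj j z && ~~ adj i z} ->
  l <= #|Y| -> l <= #|Z| -> {in Y & Z, forall y z, ~~ adj y z}.
Proof.
move=> ij indY indZ Yij Zji lY lZ.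
move/independentP: (indY) => iY; move/independentP: (indZ) => iZ.
have YP y z y' : y \in Y -> z \in Z -> y' \in Y -> adj y z -> adj y' z.
  move=> yY zZ y'Y yz; apply/negPn/negP => y'z.
  have /andP[iy jy] := Yij y yY; have /andP[iy' jy'] := Yij y' y'Y.
  have /andP[jz iz] := Zji z zZ.
  apply: (@free_no_P5 _ G y' i y z j G_free (or_introl erefl)) => //;
    rewrite ?[adj _ i]adj_sym ?[adj _ j]adj_sym //; try exact: iY.
have ZP y z z' : y \in Y -> z \in Z -> z' \in Z -> adj y z -> adj y z'.
  move=> yY zZ z'Z yz; apply/negPn/negP => yz'.
  have /andP[iy jy] := Yij y yY; have /andP[jz iz] := Zji z zZ.
  have /andP[jz' iz'] := Zji z' z'Z.
  apply: (@free_no_P5 _ G z' j z y i G_free (or_introl erefl)) => //;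
    rewrite ?[adj _ i]adj_sym ?[adj _ j]adj_sym ?[adj _ y]adj_sym //;
    by [exact: iZ | rewrite adj_sym].
move=> y z yY zZ; apply/negP => yz.
apply: (@free_no_biclique _ G l Y Z G_free (or_intror erefl)) => // y' z'.
move=> y'Y z'Z; apply: (YP y) => //; exact: (ZP y z).
Qed.

(** * Arc counting and the exchange in a maximum independent set *)

Lemma not_all_neigh_alpha_ge (X : G -> {set G}) (w : G) :
  (forall v, [/\ independent (X v), X v \subset N v & 2 * l <= #|X v|]) ->
  False.
Proof.
move=> XP.
pose P A := independent A && (A \subset N w).
have Pw : P (X w) by rewrite /P; case: (XP w) => -> ->.
case: (arg_maxnP (fun A : {set G} => #|A|) Pw) => I /andP[indI Iw] I_max.
have lI : 2 * l <= #|I| by case: (XP w) => _ _ /leq_trans; apply; apply: I_max.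
move/independentP: (indI) => iI.
pose arc i j := l <= #|N j :&: X i|.
(* The guard sits under the existential so that [Z] can be chosen as a function on all of [G], with
   the dummy value [set0] outside [I]. *)
have ZP i : exists Z : {set G}, i \in I -> [/\ Z \subset X i, l < #|Z| &
    {in I & Z, forall j z, ~~ arc i j -> ~~ adj j z}].
  case: (boolP (i \in I)) => [iI' | _]; last by exists set0.
  have [indX Xi lX] := XP i.
  have [Z [ZX lZ Zj]] := light_core indI indX iI' Xi lX.
  by exists Z => _; split=> // j z jI zZ; rewrite -ltnNge; apply: Zj.
have {ZP} [Z ZP] := fin_all_exists ZP.
have Zi i z : i \in I -> z \in Z i -> adj i z.
  move=> iI' zZ; have [_ /subsetP Xi _] := XP i.
  by have [/subsetP ZX _ _] := ZP i iI'; have:= Xi z (ZX z zZ); rewrite inE.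
have indZ i : i \in I -> independent (Z i).
  move=> iI'; have [/independentP indX _ _] := XP i.
  have [/subsetP ZX _ _] := ZP i iI'.
  by apply/independentP => x y /ZX xX /ZX yX; apply: indX.
have out_lt i : i \in I -> #|[set j in I | arc i j]| < l.
  by move=> iI'; have [indX Xi _] := XP i; apply: few_heavy Xi.
have w_adj i : i \in I -> adj w i by move/(subsetP Iw); rewrite inE.
have [i iI' wZ] : exists2 i, i \in I & Z i \subset N w.
  case: (boolP [exists i in I, Z i \subset N w]) => [/exists_inP[i] | ].
    by exists i.
  rewrite negb_exists_in => /forall_inP noZ; exfalso.
  (* The case [i = j] is included, so the double sum below runs over all of [I] times [I] without a
     diagonal correction. *)
  have arcs i j : i \in I -> j \in I -> 1 <= arc i j + arc j i.
    move=> iI' jI'; rewrite addn_gt0 !lt0b; apply/negPn/negP.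
    rewrite negb_or => /andP[ij ji].
    have [_ lZi Zij] := ZP i iI'; have [_ lZj Zji] := ZP j jI'.
    have /subsetPn[x xZ] := noZ i iI'; have /subsetPn[y yZ] := noZ j jI'.
    rewrite !inE => wy wx.
    have xy : ~~ adj x y.
      apply: (@private_anticomplete i j (Z i) (Z j)) => //; try exact: indZ;
        try exact: iI; try exact: ltnW.
        by move=> z zZ; rewrite Zi //= Zij.
      by move=> z zZ; rewrite Zi //= Zji.
    have [ix jy] := (Zi i x iI' xZ, Zi j y jI' yZ).
    have [jx iy] := (Zij j x jI' xZ ij, Zji i y iI' yZ ji).
    apply: (@free_no_P5 _ G x i w j y G_free (or_introl erefl)) => //;
      try by rewrite adj_sym // w_adj.
    - exact: w_adj.
    - exact: iI.
  have out_sum : \sum_(i in I) \sum_(j in I) arc i j <= #|I| * l.-1.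
    rewrite -sum_nat_const; apply: leq_sum => i iI'.
    rewrite -big_mkcondr /= sum1_card -ltnS prednK //.
    by have:= out_lt i iI'; rewrite cardsE.
  (* Each arc is counted twice, once in each order of its ends. The bound gives
     [|I| <= 2 * (l - 1)], against [|I| >= 2 * l]. *)
  have : #|I| * #|I| <= 2 * (#|I| * l.-1).
    apply: (@leq_trans (\sum_(i in I) \sum_(j in I) (arc i j + arc j i))).
      rewrite -sum_nat_const; apply: leq_sum => i iI'.
      by rewrite -sum1_card; apply: leq_sum => j jI'; apply: arcs.
    under eq_bigr do rewrite big_split.
    rewrite big_split /= [X in _ + X <= _]exchange_big /= addnn -mul2n.
    by rewrite leq_mul2l.
  rewrite mulnCA leq_mul2l leqNgt (leq_trans _ lI) ?orbF; last first.
    by rewrite ltn_mul2l /= ltn_predL.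
  by rewrite -leqn0 leqNgt (leq_trans _ lI) // muln_gt0.
have [_ lZ Zij] := ZP i iI'.
pose J := I :\: [set j in I | arc i j].
have indJZ : P (J :|: Z i).
  rewrite /P subUset wZ andbT (subset_trans (subsetDl _ _)) // andbT.
  have JZ x y : x \in J -> y \in Z i -> ~~ adj x y.
    by rewrite !inE => /andP[nxi xI] yZ; apply: Zij => //; move: nxi; rewrite xI.
  apply/independentP => x y /setUP[xJ | xZ] /setUP[yJ | yZ].
  - by apply: iI; [move: xJ | move: yJ]; rewrite inE => /andP[].
  - exact: JZ.
  - by rewrite adj_sym JZ.
  - exact: (elimT (independentP _) (indZ i iI')).
have: #|J :|: Z i| <= #|I| := I_max _ indJZ.
rewrite leqNgt => /negP[].
(* [Z i] consists of neighbours of [i], and [I] is independent and contains [i]. So the exchange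
   gains all of [Z i], more than [l] vertices, for fewer than [l] lost. *)
have disj : [disjoint J & Z i].
  apply/pred0P => x /=; apply/negbTE/negP => /andP[xJ xZ].
  move: xJ; rewrite inE => /andP[_ xI].
  by have:= iI i x iI' xI; rewrite Zi.
rewrite cardsU disjoint_setI0 // cards0 subn0.
rewrite -(cardsID [set j in I | arc i j] I) addnC ltn_add2l.
apply: leq_ltn_trans (ltn_trans (out_lt i iI') lZ).
exact/subset_leq_card/subsetIr.
Qed.

End P5BicliqueFree.

(** * From closed to open neighbourhoods, and the conclusion *)

Lemma alpha_closed_neigh_ge (G : sgraph) (v : G) (n : nat) :
  1 < n -> n <= alpha (induced (closed_neigh v)) ->
  exists A : {set G}, [/\ independent A, A \subset [set u | adj v u] & n <= #|A|].
Proof.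
move=> n_gt1; rewrite /alpha => n_le.
have [B indB nB] : exists2 B : {set induced (closed_neigh v)},
    independent B & n <= #|B|.
  case: (boolP [exists B : {set induced (closed_neigh v)},
                independent B && (n <= #|B|)]) => [/existsP[B /andP[]] | ].
    by exists B.
  rewrite negb_exists => /forallP noB; exfalso; move: n_le.
  rewrite leqNgt -[n in _ < n](prednK (ltnW n_gt1)) ltnS => /negP[].
  apply/bigmax_leqP => B indB; rewrite -ltnS (prednK (ltnW n_gt1)) ltnNge.
  by have:= noB B; rewrite indB.
move/independentP: indB => indB; exists [set val x | x in B]; split.
- by apply/independentP => _ _ /imsetP[x xB ->] /imsetP[y yB ->]; apply: indB.
- apply/subsetP => _ /imsetP[x xB ->]; rewrite inE.
  (* The vertex [v] is adjacent to all the rest of its closed neighbourhood, so an independent set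
     with a second element [t] cannot contain it. *)
  have:= valP x; rewrite inE => /orP[/eqP xv | //].
  have /card_gt1P[y [z [yB zB yz]]] : 1 < #|B| by apply: leq_trans nB.
  have [t tB tx] : exists2 t, t \in B & t != x.
    by have [yx | yx] := eqVneq y x; [exists z; rewrite // -yx eq_sym | exists y].
  have tv : val t != v.
    by apply: contraNneq tx => tv; apply/eqP/val_inj/(etrans tv (esym xv)).
  have:= valP t; rewrite inE (negbTE tv) /= => vt.
  have /negP[] := indB x t xB tB.
  exact: (etrans (congr1 (fun u => adj u (val t)) xv) vt).
- by rewrite card_imset //; apply: val_inj.
Qed.

Theorem theorem1p7 (l : nat) (hl : 2 <= l) (G : sgraph) (hG : 0 < #|G|)
    (hfree : free (fun H => H = path_graph 5 \/ H = biclique l l) G) :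
  exists v : G, alpha (induced (closed_neigh v)) < 2 * l.
Proof.
have l_gt0 : 0 < l by apply: ltnW.
case: (boolP [exists v : G, alpha (induced (closed_neigh v)) < 2 * l]).
  by move/existsP.
rewrite negb_exists => /forallP big.
have XP (v : G) : exists A : {set G},
    [/\ independent A, A \subset [set u | adj v u] & 2 * l <= #|A|].
  apply: alpha_closed_neigh_ge; last by rewrite leqNgt.
  by rewrite mul2n -addnn (leq_trans hl) // leq_addr.
have [X {}XP] := fin_all_exists XP.
have /card_gt0P[w _] := hG.
by case: (not_all_neigh_alpha_ge l_gt0 hfree w XP).
Qed.
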